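(* Let $a,b:\mathbb{R}_D$ be equipped with locators, and let $f:\mathbb{R}_D\to\mathbb{R}_D$ be equipped with a modulus of uniform continuity on $[a,b]$ and with a structure of lifting locators. Then $\int_a^b f(x)\,dx$ has a locator.
   Context: Work in Martin-Löf type theory with propositional truncation, function extensionality and propositional extensionality. A Dedekind real is a pair $x=(L,U)$ of proposition-valued predicates on $\mathbb{Q}$, writing $q<x$ for $q\in L$ and $x<r$ for $r\in U$, which is bounded, rounded, transitive and located ($q<r\Rightarrow\|(q<x)+(x<r)\|$). $\mathbb{R}_D$ is the type of Dedekind reals, a Cauchy complete ordered field. A locator for $x$ is a function $\prod_{q,r:\mathbb{Q}}(q<r)\to(q<x)+(x<r)$ into the untruncated disjoint sum; $\operatorname{locator}(x)$ is the type of these. $f$ lifts locators if it is equipped with an element of $\prod_{x:\mathbb{R}_D}\operatorname{locator}(x)\to\operatorname{locator}(f(x))$. A modulus of uniform continuity for $f$ on $[a,b]$ is a map $\omega:\mathbb{Q}_+\to\mathbb{Q}_+$ such that for all $x,y\in[a,b]$, $|x-y|<\omega(\varepsilon)\Rightarrow|f(x)-f(y)|<\varepsilon$. The integral is defined as $\int_a^bf(x)\,dx:=\lim_{n\to\infty}\frac{b-a}{n}\sum_{k=0}^{n-1}f\!\left(a+k\frac{b-a}{n}\right)$. *)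

(* Defs.v *)
From HB Require Import structures.
From mathcomp Require Import all_boot all_order all_algebra.
From mathcomp Require Import ring lra.
From Stdlib Require Import FunctionalExtensionality PropExtensionality.
Set Implicit Arguments. Unset Strict Implicit. Unset Printing Implicit Defensive.
Import Order.TTheory GRing.Theory Num.Theory.
Local Open Scope ring_scope.

(* Truth values are Rocq's Prop: [exists] and [\/] in Prop render the
   propositional truncations of Sigma and +, and [sumbool] the untruncated sum.
   [lower x q] reads q < x, and [upper x r] reads x < r.
   With functional and propositional extensionality, two Dedekind reals with the
   same cuts are Leibniz equal (RDle_anti below), so an arbitrary function
   RD -> RD is a function on Dedekind reals. *)
Record RD := MkRD {
  lower : rat -> Prop;
  upper : rat -> Prop;
  RD_bounded : (exists q, lower q) /\ (exists r, upper r);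
  RD_rounded :
    (forall q, lower q <-> exists q', q < q' /\ lower q') /\
    (forall r, upper r <-> exists r', r' < r /\ upper r');
  RD_transitive : forall q r, lower q -> upper r -> q < r;
  RD_located : forall q r, q < r -> lower q \/ upper r
}.

Lemma lowerW (x : RD) q q' : q <= q' -> lower x q' -> lower x q.
Proof.
rewrite le_eqVlt => /orP[/eqP-> //|qq' xq'].
by apply/(proj1 (RD_rounded x) q); exists q'.
Qed.

Lemma upperW (x : RD) r r' : r' <= r -> upper x r' -> upper x r.
Proof.
rewrite le_eqVlt => /orP[/eqP<- //|rr' xr'].
by apply/(proj2 (RD_rounded x) r); exists r'.
Qed.

Lemma lower_round (x : RD) q : lower x q -> exists q', q < q' /\ lower x q'.
Proof. by move/(proj1 (RD_rounded x) q). Qed.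

Lemma upper_round (x : RD) r : upper x r -> exists r', r' < r /\ upper x r'.
Proof. by move/(proj2 (RD_rounded x) r). Qed.

Definition near (x : RD) (p e : rat) := lower x (p - e) /\ upper x (p + e).

Lemma nearW x p e e' : e <= e' -> near x p e -> near x p e'.
Proof. by move=> ee' [l u]; split; [apply: lowerW l|apply: upperW u]; lra. Qed.

Lemma near_ex (x : RD) e : 0 < e -> exists p, near x p e.
Proof.
move=> e0; have [[q lq] [r ur]] := RD_bounded x.
have d0 : 0 < e / 3 by lra.
set d := e / 3 in d0.
have ed : e = 3 * d by rewrite /d; lra.
have [n hn] : exists n : nat, r - q < n%:R * d.
  exists (Num.truncn ((r - q) / d)).+1.
  by rewrite -ltr_pdivrMr //; apply: truncnS_gt.
elim: n q lq hn => [|n IH] q lq hn.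
  by have := RD_transitive lq ur; lra.
have [l|u] := @RD_located x (q + d) (q + 2 * d) ltac:(lra).
  by apply: (IH (q + d) l); move: hn; rewrite -natr1 mulrDl mul1r; lra.
exists (q + d); split; [apply: lowerW lq|apply: upperW u]; lra.
Qed.

Definition RDle (x y : RD) : Prop := forall q, lower x q -> lower y q.

Lemma RDle_refl x : RDle x x. Proof. by []. Qed.
Lemma RDle_trans y x z : RDle x y -> RDle y z -> RDle x z.
Proof. by move=> xy yz q /xy /yz. Qed.

Lemma RDle_upper x y : RDle x y -> forall r, upper y r -> upper x r.
Proof.
move=> xy r /upper_round[r' [r'r u]].
have [/xy l|//] := @RD_located x r' r r'r.
by have := RD_transitive l u; rewrite ltxx.
Qed.

Lemma RDle_anti x y : RDle x y -> RDle y x -> x = y.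
Proof.
move=> xy yx.
have El : lower x = lower y.
  apply: functional_extensionality => q; apply: propositional_extensionality.
  by split; [apply: xy|apply: yx].
have Eu : upper x = upper y.
  apply: functional_extensionality => q; apply: propositional_extensionality.
  by split; apply: RDle_upper.
have pi (P : Prop) (p p' : P) : p = p'.
  have EP : P = True by apply: propositional_extensionality; split.
  by move: p p'; rewrite EP => -[] [].
case: x y El Eu {xy yx} => lx ux bx rx tx cx [ly uy b r t c] /= El Eu.
by subst; f_equal; apply: pi.
Qed.

Lemma near_le x y :
  (forall e, 0 < e -> exists p p', [/\ near x p e, near y p' e & p <= p' + e]) ->
  RDle x y.
Proof.
move=> H q /lower_round[q' [qq' lq']].
have e0 : 0 < (q' - q) / 3 by lra.
have [p [p' [[lx ux] [ly uy] pp']]] := H _ e0.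
have := RD_transitive lq' ux => h.
by apply: lowerW ly; lra.
Qed.

Definition RDrat (p : rat) : RD.
Proof.
refine (@MkRD (fun q => q < p) (fun r => p < r) _ _ _ _).
- by split; [exists (p - 1)|exists (p + 1)]; lra.
- split=> q; split=> [h|[q' [h h']]]; try lra.
    by exists ((q + p) / 2); split; lra.
  by exists ((q + p) / 2); split; lra.
- by move=> q r; apply: lt_trans.
- by move=> q r qr; have [?|?] := ltP q p; [left|right]; lra.
Defined.

Definition RDadd (x y : RD) : RD.
Proof.
refine (@MkRD
  (fun q => exists s t, [/\ lower x s, lower y t & q < s + t])
  (fun r => exists s t, [/\ upper x s, upper y t & s + t < r]) _ _ _ _).
- have [[q lq] [r ur]] := RD_bounded x; have [[q' lq'] [r' ur']] := RD_bounded y.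
  by split; [exists (q + q' - 1), q, q'|exists (r + r' + 1), r, r']; split=> //; lra.
- split=> q; split.
  + move=> [s [t [ls lt h]]]; exists ((q + (s + t)) / 2); split; first lra.
    by exists s, t; split=> //; lra.
  + by move=> [q' [qq' [s [t [ls lt h]]]]]; exists s, t; split=> //; lra.
  + move=> [s [t [ls lt h]]]; exists ((q + (s + t)) / 2); split; first lra.
    by exists s, t; split=> //; lra.
  + by move=> [q' [qq' [s [t [ls lt h]]]]]; exists s, t; split=> //; lra.
- move=> q r [s [t [ls lt h]]] [s' [t' [us ut h']]].
  by have := RD_transitive ls us; have := RD_transitive lt ut; lra.
- move=> q r qr; set e := (r - q) / 5.
  have e0 : 0 < e by rewrite /e; lra.
  have [p [lp up]] := near_ex x e0; have [p' [lp' up']] := near_ex y e0.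
  have [h|h] := ltP q ((p - e) + (p' - e)).
    by left; exists (p - e), (p' - e).
  by right; exists (p + e), (p' + e); split=> //; rewrite /e in h *; lra.
Defined.

Definition RDopp (x : RD) : RD.
Proof.
refine (@MkRD (fun q => upper x (- q)) (fun r => lower x (- r)) _ _ _ _).
- have [[q lq] [r ur]] := RD_bounded x.
  by split; [exists (- r)|exists (- q)]; rewrite opprK.
- split=> q; split.
  + by move=> /upper_round[r [h u]]; exists (- r); rewrite opprK; split=> //; lra.
  + by move=> [r [h u]]; apply: upperW u; lra.
  + by move=> /lower_round[r [h u]]; exists (- r); rewrite opprK; split=> //; lra.
  + by move=> [r [h u]]; apply: lowerW u; lra.
- by move=> q r u l; have := RD_transitive l u; lra.
- move=> q r qr; have [||] := @RD_located x (- r) (- q); [lra|by right|by left].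
Defined.

Definition RDmax (x y : RD) : RD.
Proof.
refine (@MkRD (fun q => lower x q \/ lower y q)
              (fun r => upper x r /\ upper y r) _ _ _ _).
- have [[q lq] [r ur]] := RD_bounded x; have [[q' lq'] [r' ur']] := RD_bounded y.
  split; first by exists q; left.
  exists (Num.max r r'); split; [apply: upperW ur|apply: upperW ur'];
    by rewrite le_max lexx ?orbT.
- split=> q; split.
  + by case=> /lower_round[q' [h l]]; exists q'; split=> //; [left|right].
  + by case=> q' [h [l|l]]; [left|right]; apply: lowerW l; apply: ltW.
  + case=> /upper_round[r [h u]] /upper_round[r' [h' u']].
    exists (Num.max r r'); rewrite gt_max h h'; split=> //.
    by split; [apply: upperW u|apply: upperW u']; rewrite le_max lexx ?orbT.
  + by case=> r [h [u u']]; split; [apply: upperW u|apply: upperW u']; apply: ltW.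
- by move=> q r [l|l] [u u']; apply: RD_transitive l _.
- move=> q r qr; have [l|u] := @RD_located x q r qr; first by left; left.
  have [l|u'] := @RD_located y q r qr; first by left; right.
  by right.
Defined.

Lemma box_lt (q a b c d s t : rat) : a <= s <= b -> c <= t <= d ->
  [&& q < a * c, q < a * d, q < b * c & q < b * d] -> q < s * t.
Proof.
move=> /andP[as_ sb] /andP[ct td] /and4P[h1 h2 h3 h4].
have hc : q < s * c.
  have [c0|c0] := leP 0 c.
    by apply: lt_le_trans h1 _; apply: ler_wpM2r.
  by apply: lt_le_trans h3 _; apply: ler_wnM2r => //; apply: ltW.
have hd : q < s * d.
  have [c0|c0] := leP 0 d.
    by apply: lt_le_trans h2 _; apply: ler_wpM2r.
  by apply: lt_le_trans h4 _; apply: ler_wnM2r => //; apply: ltW.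
have [s0|s0] := leP 0 s.
  by apply: lt_le_trans hc _; apply: ler_wpM2l.
by apply: lt_le_trans hd _; apply: ler_wnM2l => //; apply: ltW.
Qed.

Lemma box_gt (q a b c d s t : rat) : a <= s <= b -> c <= t <= d ->
  [&& a * c < q, a * d < q, b * c < q & b * d < q] -> s * t < q.
Proof.
move=> h1 /andP[h2 h3] /and4P[g1 g2 g3 g4].
suff : - q < s * (- t) by lra.
apply: (@box_lt _ a b (- d) (- c)) => //; first by apply/andP; split; lra.
by apply/and4P; split; lra.
Qed.

Lemma box_near (p p' e c : rat) : 0 < e ->
  e * (`|p| + `|p'| + e) < c ->
  [&& p * p' - c < (p - e) * (p' - e), p * p' - c < (p - e) * (p' + e),
      p * p' - c < (p + e) * (p' - e) & p * p' - c < (p + e) * (p' + e)] /\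
  [&& (p - e) * (p' - e) < p * p' + c, (p - e) * (p' + e) < p * p' + c,
      (p + e) * (p' - e) < p * p' + c & (p + e) * (p' + e) < p * p' + c].
Proof.
move=> e0 h.
have hp : - `|p| <= p <= `|p| by rewrite -ler_norml.
have hp' : - `|p'| <= p' <= `|p'| by rewrite -ler_norml.
have h1 : - (e * `|p|) <= e * p <= e * `|p|.
  by case/andP: hp => *; rewrite -mulrN !ler_pM2l //; apply/andP; split.
have h2 : - (e * `|p'|) <= e * p' <= e * `|p'|.
  by case/andP: hp' => *; rewrite -mulrN !ler_pM2l //; apply/andP; split.
have e2 : 0 < e * e by apply: mulr_gt0.
move: h h1 h2; rewrite !mulrDr !mulrDl !(mulrN, mulNr, opprK) (mulrC p e) => h /andP[? ?] /andP[? ?].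
by split; apply/and4P; split; lra.
Qed.

Lemma mul_rad (B e : rat) : 0 < e -> 0 <= B -> exists d,
  [/\ 0 < d, d <= 1 & d * (B + 1) < e].
Proof.
move=> e0 B0; have h : 0 < B + 1 by lra.
exists (Num.min 1 (e / 2 / (B + 1))); split.
- by rewrite lt_min ltr01 divr_gt0 //; lra.
- by rewrite ge_min lexx.
- apply: (@le_lt_trans _ _ (e / 2)); last lra.
  by rewrite -ler_pdivlMr // ge_min lexx orbT.
Qed.

Lemma near_bound (x : RD) : exists B, 0 <= B /\
  forall p e, e <= 1 -> near x p e -> `|p| <= B.
Proof.
have [[q lq] [r ur]] := RD_bounded x.
exists (`|q| + `|r| + 1); split; first by rewrite !addr_ge0.
move=> p e e1 [l u].
have := RD_transitive l ur; have := RD_transitive lq u => h h'.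
have hq : - `|q| <= q <= `|q| by rewrite -ler_norml.
have hr : - `|r| <= r <= `|r| by rewrite -ler_norml.
have := normr_ge0 q; have := normr_ge0 r => ? ?.
by case/andP: hq => *; case/andP: hr => *; rewrite ler_norml; apply/andP; split; lra.
Qed.

Lemma mul_near_ex (x y : RD) e : 0 < e -> exists d,
  [/\ 0 < d, d <= 1 & forall p p', near x p d -> near y p' d ->
    d * (`|p| + `|p'| + d) < e].
Proof.
move=> e0; have [B [B0 hB]] := near_bound x; have [B' [B'0 hB']] := near_bound y.
have [d [d0 d1 hd]] := @mul_rad (B + B') e e0 ltac:(lra).
exists d; split=> // p p' /(hB _ _ d1) h /(hB' _ _ d1) h'.
apply: le_lt_trans hd; rewrite ler_pM2l //; lra.
Qed.

(* The interval product: a < x < b, c < y < d and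
   q < min(ac, ad, bc, bd), respectively max(ac, ad, bc, bd) < r. *)
Definition RDmul (x y : RD) : RD.
Proof.
refine (@MkRD
  (fun q => exists a b c d, [/\ lower x a, upper x b, lower y c, upper y d &
     [&& q < a * c, q < a * d, q < b * c & q < b * d]])
  (fun r => exists a b c d, [/\ lower x a, upper x b, lower y c, upper y d &
     [&& a * c < r, a * d < r, b * c < r & b * d < r]]) _ _ _ _).
- have [d [d0 d1 hd]] := mul_near_ex x y ltr01.
  have [p np] := near_ex x d0; have [p' np'] := near_ex y d0.
  have [hl hu] := box_near d0 (hd _ _ np np').
  case: np np' => ? ? [? ?].
  by split; [exists (p * p' - 1)|exists (p * p' + 1)];
     exists (p - d), (p + d), (p' - d), (p' + d).
- split=> q; split.
  + move=> [a [b [c [d [? ? ? ? /and4P[h1 h2 h3 h4]]]]]].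
    set m := Num.min (Num.min (a * c) (a * d)) (Num.min (b * c) (b * d)).
    have qm : q < m by rewrite !lt_min h1 h2 h3 h4.
    have : [&& m <= a * c, m <= a * d, m <= b * c & m <= b * d].
      by rewrite !ge_min !lexx ?orbT.
    case/and4P=> *; exists ((q + m) / 2); split; first lra.
    by exists a, b, c, d; split=> //; apply/and4P; split; lra.
  + move=> [q' [qq' [a [b [c [d [? ? ? ? /and4P[h1 h2 h3 h4]]]]]]]].
    by exists a, b, c, d; split=> //; apply/and4P; split; lra.
  + move=> [a [b [c [d [? ? ? ? /and4P[h1 h2 h3 h4]]]]]].
    set m := Num.max (Num.max (a * c) (a * d)) (Num.max (b * c) (b * d)).
    have qm : m < q by rewrite !gt_max h1 h2 h3 h4.
    have : [&& a * c <= m, a * d <= m, b * c <= m & b * d <= m].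
      by rewrite !le_max !lexx ?orbT.
    case/and4P=> *; exists ((q + m) / 2); split; first lra.
    by exists a, b, c, d; split=> //; apply/and4P; split; lra.
  + move=> [q' [qq' [a [b [c [d [? ? ? ? /and4P[h1 h2 h3 h4]]]]]]]].
    by exists a, b, c, d; split=> //; apply/and4P; split; lra.
- move=> q r [a [b [c [d [la ub lc ud hq]]]]] [a' [b' [c' [d' [la' ub' lc' ud' hr]]]]].
  have [[s hs] [t ht]] : (exists s, a <= s <= b /\ a' <= s <= b') /\
                         (exists t, c <= t <= d /\ c' <= t <= d').
    have T := fun x => @RD_transitive x.
    have := T _ _ _ la ub; have := T _ _ _ la ub'; have := T _ _ _ la' ub; have := T _ _ _ la' ub'.
    have := T _ _ _ lc ud; have := T _ _ _ lc ud'; have := T _ _ _ lc' ud; have := T _ _ _ lc' ud'.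
    move=> *; split; [exists (Num.max a a')|exists (Num.max c c')];
      by rewrite !le_max !ge_max !lexx ?orbT /= !ltW.
  have := box_lt hs.1 ht.1 hq; have := box_gt hs.2 ht.2 hr; lra.
- move=> q r qr; have e0 : 0 < (r - q) / 3 by lra.
  have [d [d0 d1 hd]] := mul_near_ex x y e0.
  have [p np] := near_ex x d0; have [p' np'] := near_ex y d0.
  have [/and4P[? ? ? ?] /and4P[? ? ? ?]] := box_near d0 (hd _ _ np np').
  case: np np' => ? ? [? ?].
  by have [h|h] := leP q (p * p' - (r - q) / 3); [left|right];
     exists (p - d), (p + d), (p' - d), (p' + d); split=> //; apply/and4P; split; lra.
Defined.

Declare Scope RD_scope.
Delimit Scope RD_scope with RD.
Bind Scope RD_scope with RD.
Notation "x + y" := (RDadd x y) : RD_scope.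
Notation "- x" := (RDopp x) : RD_scope.
Notation "x - y" := (RDadd x (RDopp y)) : RD_scope.
Notation "x * y" := (RDmul x y) : RD_scope.
Notation "x <= y" := (RDle x y) : RD_scope.
Notation "p %:RD" := (RDrat p) (at level 2, left associativity, format "p %:RD") : RD_scope.

Definition RDabs (x : RD) : RD := RDmax x (- x)%RD.
Notation "`| x |" := (RDabs x) : RD_scope.

(* F is approximated by G p q r when p, q, r approximate x, y, z; ring identities
   on RD are thereby reduced to identities on rat. *)
Definition cont (x y z F : RD) (G : rat -> rat -> rat -> rat) :=
  forall e, 0 < e -> exists d, 0 < d /\ forall p q r,
    near x p d -> near y q d -> near z r d -> near F (G p q r) e.

Lemma cont1 x y z : cont x y z x (fun p q r => p).
Proof. by move=> e e0; exists e. Qed.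
Lemma cont2 x y z : cont x y z y (fun p q r => q).
Proof. by move=> e e0; exists e. Qed.
Lemma cont3 x y z : cont x y z z (fun p q r => r).
Proof. by move=> e e0; exists e. Qed.
Lemma contC x y z c : cont x y z c%:RD (fun p q r => c).
Proof. by move=> e e0; exists e; split=> // p q r _ _ _; split; simpl; lra. Qed.

Lemma cont_pair x y z F G F' G' : cont x y z F G -> cont x y z F' G' ->
  forall e, 0 < e -> exists d, 0 < d /\ forall p q r,
    near x p d -> near y q d -> near z r d ->
    near F (G p q r) e /\ near F' (G' p q r) e.
Proof.
move=> H H' e e0; have [d [d0 h]] := H e e0; have [d' [d'0 h']] := H' e e0.
exists (Num.min d d'); split; first by rewrite lt_min d0.
have m1 : Num.min d d' <= d by rewrite ge_min lexx.
have m2 : Num.min d d' <= d' by rewrite ge_min lexx orbT.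
move=> p q r nx ny nz; split; [apply: h|apply: h'];
  by [apply: nearW nx|apply: nearW ny|apply: nearW nz].
Qed.

Lemma contD x y z F G F' G' : cont x y z F G -> cont x y z F' G' ->
  cont x y z (F + F')%RD (fun p q r => G p q r + G' p q r).
Proof.
move=> H H' e e0; have [|d [d0 h]] := cont_pair H H' (e := e / 3); first lra.
exists d; split=> // p q r nx ny nz; have [[l u] [l' u']] := h _ _ _ nx ny nz.
split=> /=.
  by exists (G p q r - e / 3), (G' p q r - e / 3); split=> //; lra.
by exists (G p q r + e / 3), (G' p q r + e / 3); split=> //; lra.
Qed.

Lemma contN x y z F G : cont x y z F G -> cont x y z (- F)%RD (fun p q r => - G p q r).
Proof.
move=> H e e0; have [d [d0 h]] := H e e0.
exists d; split=> // p q r nx ny nz; have [l u] := h _ _ _ nx ny nz.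
by split=> /=; [apply: upperW u|apply: lowerW l]; lra.
Qed.

Lemma contM x y z F G F' G' : cont x y z F G -> cont x y z F' G' ->
  cont x y z (F * F')%RD (fun p q r => G p q r * G' p q r).
Proof.
move=> H H' e e0; have [d [d0 d1 hd]] := mul_near_ex F F' e0.
have [c [c0 h]] := cont_pair H H' d0.
exists c; split=> // p q r nx ny nz; have [n n'] := h _ _ _ nx ny nz.
have [hl hu] := box_near d0 (hd _ _ n n').
case: n n' => ? ? [? ?].
by split=> /=; exists (G p q r - d), (G p q r + d), (G' p q r - d), (G' p q r + d).
Qed.

Lemma cont_le x y z F G F' G' : cont x y z F G -> cont x y z F' G' ->
  (forall p q r, G p q r <= G' p q r) -> (F <= F')%RD.
Proof.
move=> H H' le; apply: near_le => e e0.
have [d [d0 h]] := cont_pair H H' e0.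
have [[p np] [q nq] [r nr]] := And3 (near_ex x d0) (near_ex y d0) (near_ex z d0).
have [n n'] := h _ _ _ np nq nr.
by exists (G p q r), (G' p q r); split=> //; have := le p q r; lra.
Qed.

Lemma cont_eq x y z F G F' G' : cont x y z F G -> cont x y z F' G' ->
  (forall p q r, G p q r = G' p q r) -> F = F'.
Proof.
move=> H H' E; apply: RDle_anti; first by apply: (cont_le H H') => *; rewrite E.
by apply: (cont_le H' H) => *; rewrite E.
Qed.

Ltac cont_tac :=
  lazymatch goal with
  | |- cont _ _ _ (RDrat _) _ => exact: contC
  | |- cont ?x _ _ ?x _ => exact: cont1
  | |- cont _ ?y _ ?y _ => exact: cont2
  | |- cont _ _ ?z ?z _ => exact: cont3
  | |- cont _ _ _ (RDadd _ _) _ => apply: contD; [cont_tac|cont_tac]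
  | |- cont _ _ _ (RDmul _ _) _ => apply: contM; [cont_tac|cont_tac]
  | |- cont _ _ _ (RDopp _) _ => apply: contN; cont_tac
  end.

Ltac RDeq x y z :=
  eapply (@cont_eq x y z); [cont_tac|cont_tac|move=> ? ? ? /=].

Lemma RDaddA : associative RDadd.
Proof. move=> x y z; RDeq x y z; ring. Qed.
Lemma RDaddC : commutative RDadd.
Proof. move=> x y; RDeq x y y; ring. Qed.
Lemma RDadd0 : left_id 0%:RD%RD RDadd.
Proof. move=> x; RDeq x x x; ring. Qed.
Lemma RDsubrr x : (x - x = 0%:RD)%RD.
Proof. RDeq x x x; ring. Qed.
Lemma RDmulA : associative RDmul.
Proof. move=> x y z; RDeq x y z; ring. Qed.
Lemma RDmulC : commutative RDmul.
Proof. move=> x y; RDeq x y y; ring. Qed.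
Lemma RDmul1 : left_id 1%:RD%RD RDmul.
Proof. move=> x; RDeq x x x; ring. Qed.
Lemma RDmulDr : right_distributive RDmul RDadd.
Proof. move=> x y z; RDeq x y z; ring. Qed.
Lemma RDratD p q : ((p + q)%:RD = p%:RD + q%:RD)%RD.
Proof. by RDeq 0%:RD%RD 0%:RD%RD 0%:RD%RD. Qed.
Lemma RDratM p q : ((p * q)%:RD = p%:RD * q%:RD)%RD.
Proof. by RDeq 0%:RD%RD 0%:RD%RD 0%:RD%RD. Qed.

HB.instance Definition _ :=
  Monoid.isComLaw.Build RD 0%:RD%RD RDadd RDaddA RDaddC RDadd0.

Lemma RDadd_le x y x' y' : (x <= x' -> y <= y' -> x + y <= x' + y')%RD.
Proof.
by move=> h h' q [s [t [l l' lt]]]; exists s, t; split; [apply: h|apply: h'|].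
Qed.

Lemma RDsubr_ge0 x y : (x <= y -> 0%:RD <= y - x)%RD.
Proof. by move=> h; rewrite -(RDsubrr x); apply: RDadd_le. Qed.

Lemma RDsubr_ge0P x y : (0%:RD <= y - x -> x <= y)%RD.
Proof.
move=> h; rewrite -[x]RDadd0.
have -> : (y = (y - x) + x)%RD by RDeq x y y; ring.
by apply: RDadd_le.
Qed.

Lemma RDopp_le x y : (x <= y -> - y <= - x)%RD.
Proof.
move=> h; apply: RDsubr_ge0P.
have -> : (- x - - y = y - x)%RD by RDeq x y y; ring.
exact: RDsubr_ge0.
Qed.

Lemma RDmul_ge0 x y : (0%:RD <= x -> 0%:RD <= y -> 0%:RD <= x * y)%RD.
Proof.
move=> hx hy q /= q0.
have [_ [b ub]] := RD_bounded x; have [_ [d ud]] := RD_bounded y.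
have b0 : 0 < b.
  have [b' [? ub']] := upper_round ub.
  have [|b0] := leP 0 b'; first lra.
  have := RD_transitive (hx _ b0) ub'; lra.
have d0 : 0 < d.
  have [d' [? ud']] := upper_round ud.
  have [|d0] := leP 0 d'; first lra.
  have := RD_transitive (hy _ d0) ud'; lra.
have [e [e0 e1 he]] := @mul_rad (b + d) (- q) ltac:(lra) ltac:(lra).
have ? : 0 < e * b by apply: mulr_gt0.
have ? : 0 < e * d by apply: mulr_gt0.
have ? : 0 < e * e by apply: mulr_gt0.
have ? : 0 < b * d by apply: mulr_gt0.
move: he; rewrite !mulrDr mulr1 => he.
exists (- e), b, (- e), d; split=> //; try by [apply: hx => /=; lra|apply: hy => /=; lra].
by rewrite !(mulrN, mulNr) opprK (mulrC b e); apply/and4P; split; lra.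
Qed.

Lemma RDmul_le c x y : (0%:RD <= c -> x <= y -> c * x <= c * y)%RD.
Proof.
move=> hc h; apply: RDsubr_ge0P.
have -> : (c * y - c * x = c * (y - x))%RD by RDeq c x y; ring.
by apply: RDmul_ge0 => //; apply: RDsubr_ge0.
Qed.

Lemma RDrat_le p q : p <= q -> (p%:RD <= q%:RD)%RD.
Proof. by move=> h s /= hs; lra. Qed.

Lemma upper_le x r : upper x r <-> exists r', r' < r /\ (x <= r'%:RD)%RD.
Proof.
split=> [/upper_round[r' [h u]]|[r' [h u]]].
  by exists r'; split=> // q lq /=; apply: RD_transitive lq u.
by apply: (RDle_upper u) => /=.
Qed.

Definition absle (x c : RD) := (x <= c)%RD /\ (- x <= c)%RD.

Lemma absleD x y c c' : absle x c -> absle y c' -> absle (x + y)%RD (c + c')%RD.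
Proof.
move=> [h1 h2] [h3 h4]; split; first exact: RDadd_le.
have -> : (- (x + y) = - x + - y)%RD by RDeq x y y; ring.
exact: RDadd_le.
Qed.

Lemma absleM k x c : (0%:RD <= k)%RD -> absle x c -> absle (k * x)%RD (k * c)%RD.
Proof.
move=> k0 [h1 h2]; split; first exact: RDmul_le.
have -> : (- (k * x) = k * - x)%RD by RDeq x k k; ring.
exact: RDmul_le.
Qed.

Lemma absle_sum n (u : nat -> RD) (c : rat) :
  (forall k, (k < n)%N -> absle (u k) c%:RD) ->
  absle (\big[RDadd/0%:RD%RD]_(k < n) u k) (n%:R * c)%:RD%RD.
Proof.
elim: n => [|n IH] h.
  rewrite big_ord0 mul0r; split=> //.
  by have -> : (- 0%:RD = 0%:RD)%RD by RDeq 0%:RD%RD 0%:RD%RD 0%:RD%RD; ring.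
rewrite big_ord_recr /= -natr1 mulrDl mul1r RDratD; apply: absleD; last exact: h.
by apply: IH => k kn; apply: h; apply: ltnW.
Qed.

Lemma absle_upper x c r : absle x c -> upper c r -> upper `|x|%RD r.
Proof. by move=> [h1 h2] u; split; apply: RDle_upper u. Qed.

Lemma upper_absle x r : upper `|x|%RD r -> absle x r%:RD%RD.
Proof.
case=> u l; split; first by move=> q lq /=; apply: RD_transitive lq u.
by move=> q lq /=; apply: RD_transitive lq l.
Qed.

Definition cauchy (u : nat -> RD) : Prop :=
  forall e : rat, 0 < e -> exists N : nat, forall m n : nat,
    (N <= m)%N -> (N <= n)%N -> upper `|u m - u n|%RD e.

Lemma lower_dist x y e q : upper `|x - y|%RD e -> lower y q -> lower x (q - e).
Proof.
move=> [_ [s [t [l u h]]]] lq.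
have := @RD_transitive y q (- t); move=> T.
apply: lowerW l.
by have := T lq u; lra.
Qed.

Lemma RDabs_subC x y : (`|x - y| = `|y - x|)%RD.
Proof.
have E u v : (- (u - v) = v - u)%RD by RDeq u v v; ring.
by rewrite /RDabs !E; apply: RDle_anti => q /=; tauto.
Qed.

Lemma upper_dist x y e r : upper `|x - y|%RD e -> upper y r -> upper x (r + e).
Proof.
move=> [[s [t [l u h]]] _] lq.
apply: upperW l.
by have := RD_transitive u lq; lra.
Qed.

Definition cvg_to (u : nat -> RD) (l : RD) : Prop :=
  forall e : rat, 0 < e -> exists N : nat, forall n : nat,
    (N <= n)%N -> upper `|u n - l|%RD e.

Lemma cvg_to_unique u l l' : cvg_to u l -> cvg_to u l' -> l = l'.
Proof.
wlog suff : l l' / cvg_to u l -> cvg_to u l' -> (l <= l')%RD.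
  by move=> h c c'; apply: RDle_anti; apply: h.
move=> c c'; apply: near_le => e e0; have e1 : 0 < e / 2 by lra.
have [N hN] := c _ e1; have [N' hN'] := c' _ e1.
have := hN _ (leq_maxl N N'); have := hN' _ (leq_maxr N N').
rewrite RDabs_subC (RDabs_subC _ l) => h' h.
have [p [lp up]] := near_ex (u (maxn N N')) e1.
exists p, p; split; last lra.
  by split; [apply: lowerW (lower_dist h lp)|apply: upperW (upper_dist h up)]; lra.
by split; [apply: lowerW (lower_dist h' lp)|apply: upperW (upper_dist h' up)]; lra.
Qed.

Section Limit.
Variables (u : nat -> RD) (cu : cauchy u).

Definition RDlim : RD.
Proof.
refine (@MkRD
  (fun q => exists q', q < q' /\
     exists N : nat, forall n : nat, (N <= n)%N -> lower (u n) q')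
  (fun r => exists r', r' < r /\
     exists N : nat, forall n : nat, (N <= n)%N -> upper (u n) r') _ _ _ _).
- have [N hN] := cu ltr01; have [[q lq] [r ur]] := RD_bounded (u N).
  split.
    exists (q - 2), (q - 1); split; first lra.
    by exists N => n Nn; apply: (lower_dist _ lq); apply: hN.
  exists (r + 2), (r + 1); split; first lra.
  by exists N => n Nn; apply: (upper_dist _ ur); apply: hN.
- split=> q; split.
  + move=> [q' [h H]]; exists ((q + q') / 2); split; first lra.
    by exists q'; split=> //; lra.
  + by move=> [q' [h [q'' [h' H]]]]; exists q''; split=> //; lra.
  + move=> [q' [h H]]; exists ((q + q') / 2); split; first lra.
    by exists q'; split=> //; lra.
  + by move=> [q' [h [q'' [h' H]]]]; exists q''; split=> //; lra.
- move=> q r [q' [hq [N hN]]] [r' [hr [M hM]]].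
  have := RD_transitive (hN _ (leq_maxl N M)) (hM _ (leq_maxr N M)); lra.
- move=> q r qr; have e0 : 0 < (r - q) / 5 by lra.
  have [N hN] := cu e0.
  have [l|l] := @RD_located (u N) (q + 2 * ((r - q) / 5)) (q + 3 * ((r - q) / 5)) ltac:(lra).
    left; exists (q + ((r - q) / 5)); split; first lra.
    exists N => n Nn; apply: lowerW (lower_dist (hN _ _ Nn (leqnn _)) l); lra.
  right; exists (r - ((r - q) / 5)); split; first lra.
  exists N => n Nn; apply: upperW (upper_dist (hN _ _ Nn (leqnn _)) l); lra.
Defined.

Lemma RDlim_cvg : cvg_to u RDlim.
Proof.
move=> e e0; have e1 : 0 < e / 6 by lra.
have [N hN] := cu e1; have [p [lp up]] := near_ex (u N) e1.
have lL : lower RDlim (p - 3 * (e / 6)).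
  exists (p - 2 * (e / 6)); split; first lra.
  exists N => n Nn; apply: lowerW (lower_dist (hN _ _ Nn (leqnn _)) lp); lra.
have uL : upper RDlim (p + 3 * (e / 6)).
  exists (p + 2 * (e / 6)); split; first lra.
  exists N => n Nn; apply: upperW (upper_dist (hN _ _ Nn (leqnn _)) up); lra.
exists N => n Nn.
have l := lower_dist (hN _ _ Nn (leqnn _)) lp.
have r := upper_dist (hN _ _ Nn (leqnn _)) up.
split=> /=.
  exists (p + e / 6 + e / 6), (- (p - 3 * (e / 6))); rewrite opprK; split=> //; lra.
exists (p - e / 6 - e / 6), (- (p + 3 * (e / 6))); rewrite opprK; split=> //; lra.
Qed.
End Limit.

Definition locator (x : RD) : Type :=
  forall q r : rat, q < r -> {lower x q} + {upper x r}.

Definition lifts_locators (f : RD -> RD) : Type :=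
  forall x : RD, locator x -> locator (f x).

Definition posrat := {q : rat | 0 < q}.

Record uc_modulus (f : RD -> RD) (a b : RD) := UCModulus {
  ucm_fun : posrat -> posrat;
  ucm_spec : forall (e : posrat) (x y : RD),
    (a <= x)%RD /\ (x <= b)%RD -> (a <= y)%RD /\ (y <= b)%RD ->
    upper `|x - y|%RD (sval (ucm_fun e)) -> upper `|f x - f y|%RD (sval e)
}.

(* For n = 0 this is 0, which plays no role in the limit. *)
Definition riemann_sum (f : RD -> RD) (a b : RD) (n : nat) : RD :=
  let h := ((b - a) * (n%:R^-1)%:RD)%RD in
  (h * \big[RDadd/0%:RD]_(k < n) f (a + (k%:R)%:RD * h))%RD.

Section RiemannCauchy.
Variables (f : RD -> RD) (a b : RD).
Hypothesis ab : (a <= b)%RD.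
Variable w : uc_modulus f a b.

Let d : RD := (b - a)%RD.

Let d0 : (0%:RD <= d)%RD. Proof. exact: RDsubr_ge0. Qed.
Let pt (c : rat) : RD := (a + c%:RD * d)%RD.

Let pt_itv c : 0 <= c <= 1 -> (a <= pt c)%RD /\ (pt c <= b)%RD.
Proof.
case/andP=> c0 c1; split; apply: RDsubr_ge0P.
  have -> : (pt c - a = c%:RD * d)%RD by rewrite /pt; RDeq a d d; ring.
  by apply: RDmul_ge0 => //; apply: RDrat_le.
have -> : (b - pt c = (1 - c)%:RD * d)%RD by rewrite /pt /d; RDeq a b b; ring.
by apply: RDmul_ge0 => //; apply: RDrat_le; lra.
Qed.

Lemma riemann_sumE n : (0 < n)%N ->
  riemann_sum f a b n =
    (d * (n%:R^-1)%:RD * \big[RDadd/0%:RD]_(k < n) f (pt (k%:R / n%:R)))%RD.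
Proof.
move=> n0; rewrite /riemann_sum; congr RDmul; apply: eq_bigr => k _; congr f.
by rewrite /pt /d; RDeq a b b; ring.
Qed.

Lemma big_const_RD n (x : RD) : \big[RDadd/0%:RD%RD]_(k < n) x = ((n%:R)%:RD * x)%RD.
Proof.
elim: n => [|n IH]; first by rewrite big_ord0; RDeq x x x; ring.
by rewrite big_ord_recr /= IH -natr1; RDeq x x x; ring.
Qed.

Lemma big_mulr_RD n (x : RD) (u : nat -> RD) :
  (\big[RDadd/0%:RD]_(k < n) (x * u k) = x * \big[RDadd/0%:RD]_(k < n) u k)%RD.
Proof.
elim: n => [|n IH]; first by rewrite !big_ord0; RDeq x x x; ring.
by rewrite !big_ord_recr /= IH RDmulDr.
Qed.

Lemma big_sub_RD n (u v : nat -> RD) :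
  ((\big[RDadd/0%:RD]_(k < n) u k) - (\big[RDadd/0%:RD]_(k < n) v k) =
   \big[RDadd/0%:RD]_(k < n) (u k - v k))%RD.
Proof.
elim: n => [|n IH]; first by rewrite !big_ord0 RDsubrr.
rewrite !big_ord_recr /= -IH.
set U := \big[_/_]_(_ < _) _; set V := \big[_/_]_(_ < _) _.
have E x y z t : (x + y - (z + t) = (x - z) + (y - t))%RD.
  have -> : (- (z + t) = - z - t)%RD by RDeq z t t; ring.
  by rewrite -!RDaddA; congr RDadd; RDeq y z t; ring.
exact: E.
Qed.

Lemma big_mul_RD n m (u : nat -> RD) :
  \big[RDadd/0%:RD%RD]_(i < n * m) u i =
  \big[RDadd/0%:RD%RD]_(k < n) \big[RDadd/0%:RD%RD]_(j < m) u (k * m + j)%N.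
Proof.
elim: n => [|n IH]; first by rewrite mul0n !big_ord0.
rewrite big_ord_recr /= -IH mulSn addnC big_split_ord /=.
by congr RDadd.
Qed.

Lemma riemann_refine (e : posrat) D n m : upper d D -> (0 < n)%N -> (0 < m)%N ->
  D / n%:R < sval (ucm_fun w e) ->
  absle (riemann_sum f a b n - riemann_sum f a b (n * m))%RD (d * (sval e)%:RD)%RD.
Proof.
move=> uD n0 m0 hw.
have n0' : 0 < n%:R :> rat by rewrite ltr0n.
have m0' : 0 < m%:R :> rat by rewrite ltr0n.
have D0 : 0 < D.
  have [D' [? uD']] := upper_round uD.
  have [|h] := leP 0 D'; first lra.
  by have := RD_transitive (d0 h) uD'; lra.
rewrite !riemann_sumE ?muln_gt0 ?n0 //.
pose K : RD := (d * ((n * m)%:R^-1)%:RD)%RD.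
pose F k j : RD := f (pt ((k * m + j)%N%:R / (n * m)%N%:R)).
have -> : (d * (n%:R^-1)%:RD * \big[RDadd/0%:RD]_(k < n) f (pt (k%:R / n%:R)) =
  K * \big[RDadd/0%:RD]_(k < n) \big[RDadd/0%:RD]_(j < m) f (pt (k%:R / n%:R)))%RD.
  under [in RHS]eq_bigr do rewrite big_const_RD.
  rewrite (big_mulr_RD n (m%:R)%:RD (fun k => f (pt (k%:R / n%:R)))) /K.
  set S := \big[_/_]_(_ < _) _.
  by RDeq d S S; rewrite natrM; field; rewrite !gt_eqF.
have -> : (\big[RDadd/0%:RD]_(k < n * m) f (pt (k%:R / (n * m)%:R)) =
  \big[RDadd/0%:RD]_(k < n) \big[RDadd/0%:RD]_(j < m) F k j)%RD.
  by rewrite (big_mul_RD n m (fun k => f (pt (k%:R / (n * m)%:R)))).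
have EM x y : (K * x - K * y = K * (x - y))%RD by RDeq K x y; ring.
rewrite EM.
rewrite (big_sub_RD n (fun k => \big[RDadd/0%:RD%RD]_(j < m) f (pt (k%:R / n%:R)))
  (fun k => \big[RDadd/0%:RD%RD]_(j < m) F k j)).
have -> : (d * (sval e)%:RD = K * (n%:R * (m%:R * sval e))%:RD)%RD.
  by rewrite /K; RDeq d d d; rewrite natrM; field; rewrite !gt_eqF.
apply: absleM.
  by apply: RDmul_ge0 => //; apply: RDrat_le; rewrite invr_ge0 ler0n.
apply: (@absle_sum n (fun k => (\big[RDadd/0%:RD]_(j < m) f (pt (k%:R / n%:R)) -
  \big[RDadd/0%:RD]_(j < m) F k j)%RD)) => k kn.
rewrite (big_sub_RD m (fun j => f (pt (k%:R / n%:R))) (F k)).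
apply: (@absle_sum m (fun j => (f (pt (k%:R / n%:R)) - F k j)%RD)) => j jm.
apply: upper_absle; apply: (ucm_spec (u := w)).
- apply: pt_itv; rewrite divr_ge0 //= ler_pdivrMr // mul1r ler_nat; exact: ltnW.
- apply: pt_itv; rewrite divr_ge0 //= ler_pdivrMr ?ltr0n ?muln_gt0 ?n0 // mul1r ler_nat.
  apply: (@leq_trans (k * m + m)); first by rewrite leq_add2l ltnW.
  by rewrite addnC -mulSn leq_mul2r kn orbT.
- set c := j%:R / (n * m)%N%:R : rat.
  have c0 : 0 <= c by rewrite divr_ge0.
  have cn : c <= n%:R^-1.
    rewrite /c natrM invfM mulrCA ler_piMr ?invr_ge0 ?ler0n //.
    by rewrite ler_pdivrMr // mul1r ler_nat ltnW.
  have E : (pt (k%:R / n%:R) - pt ((k * m + j)%N%:R / (n * m)%N%:R) = - (c%:RD * d))%RD.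
    by rewrite /pt /c; RDeq a d d; rewrite natrD !natrM; field; rewrite !gt_eqF.
  have dD : (d <= D%:RD)%RD by move=> q lq /=; apply: RD_transitive lq uD.
  apply: (@absle_upper _ (D / n%:R)%:RD%RD) => //.
  have cd0 : (0%:RD <= c%:RD * d)%RD by apply: RDmul_ge0 => //; apply: RDrat_le.
  rewrite E; split.
    apply: (@RDle_trans (- 0%:RD)%RD); first exact: RDopp_le.
    have -> : (- 0%:RD = 0%:RD)%RD by RDeq d d d; ring.
    by apply: RDrat_le; rewrite divr_ge0 // ltW.
  have -> : (- - (c%:RD * d) = c%:RD * d)%RD by RDeq d d d; ring.
  apply: (@RDle_trans (c%:RD * D%:RD)%RD).
    by apply: RDmul_le => //; apply: RDrat_le.
  by rewrite -RDratM; apply: RDrat_le; rewrite mulrC ler_pM2l.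
Qed.

Lemma riemann_sum_cauchy : cauchy (riemann_sum f a b).
Proof.
move=> e e0; have [_ [D0 uD0]] := RD_bounded d.
pose D := Num.max D0 1.
have uD : upper d D by apply: upperW uD0; rewrite le_max lexx.
have D1 : 0 < D by rewrite lt_max ltr01 orbT.
have t0 : 0 < e / (2 * D) by rewrite divr_gt0 //; lra.
pose t : posrat := exist (fun q : rat => is_true (0 < q)) _ t0.
set wt := sval (ucm_fun w t).
have wt0 : 0 < wt := svalP (ucm_fun w t).
pose N := (Num.truncn (D / wt)).+1.
have hN n : (N <= n)%N -> (0 < n)%N /\ D / n%:R < wt.
  move=> Nn; have n0 : (0 < n)%N by apply: leq_trans Nn.
  split=> //; rewrite ltr_pdivrMr ?ltr0n // mulrC -ltr_pdivrMr //.
  by apply: lt_le_trans (truncnS_gt _) _; rewrite ler_nat.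
exists N => m n /hN[m0 hm] /hN[n0 hn].
have h1 := riemann_refine uD m0 n0 hm.
have h2 := riemann_refine uD n0 m0 hn.
rewrite mulnC in h2.
set R_ := riemann_sum f a b in h1 h2 *.
have h2' : absle (- (R_ n - R_ (m * n)%N))%RD (d * (sval t)%:RD)%RD.
  case: h2 => h2 h2'; split=> //.
  by have -> : (- - (R_ n - R_ (m * n)%N) = R_ n - R_ (m * n)%N)%RD
    by RDeq (R_ n) (R_ (m * n)%N) (R_ n); ring.
have [h3 h4] := absleD h1 h2'.
move: h3 h4; set x := R_ m; set y := R_ n.
set z := R_ (m * n)%N => h3 h4.
apply: (@absle_upper _ (d * (e / D)%:RD)%RD); last first.
  have [D' [D'D uD']] := upper_round uD.
  apply/upper_le; exists (D' * (e / D)); split.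
    by rewrite mulrCA -ltr_pdivlMl // mulVf ?gt_eqF // ltr_pdivrMr // mul1r.
  have eD : 0 <= e / D by rewrite divr_ge0 // ltW.
  rewrite RDmulC (mulrC D') (RDratM (e / D) D'); apply: RDmul_le; first exact: RDrat_le.
  by move=> q lq /=; apply: RD_transitive lq uD'.
have E : (d * (sval t)%:RD + d * (sval t)%:RD = d * (e / D)%:RD)%RD.
  by RDeq d d d; rewrite /=; field; rewrite gt_eqF.
rewrite E in h3 h4.
have E' : (x - z - (y - z) = x - y)%RD by RDeq x y z; ring.
by rewrite E' in h3 h4.
Qed.

End RiemannCauchy.

(* The limit exists because f is uniformly continuous on [a, b] and a <= b; by
   integral_cvg and cvg_to_unique it does not depend on the choice of w. *)
Definition integral (f : RD -> RD) (a b : RD) (ab : (a <= b)%RD)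
  (w : uc_modulus f a b) : RD :=
  RDlim (riemann_sum_cauchy ab w).

Lemma integral_cvg f a b (ab : (a <= b)%RD) (w : uc_modulus f a b) :
  cvg_to (riemann_sum f a b) (integral ab w).
Proof. exact: RDlim_cvg. Qed.

(* Main.v *)
(** Excluded middle together with choice would give every real a locator, so
    every construction is carried out on data and uses neither.

    A locator for [x] amounts to a function computing rational approximations of
    [x] to any precision: an approximation exists, the locator turns the search
    for one into a decidable problem, and [rat] is countable. In this form
    locators pass to sums and products, hence to the Riemann sums of [f], and to
    limits of sequences with a modulus of convergence. Two Riemann sums with [m]
    and [n] points are both compared with their common refinement with [m * n]
    points; a rational upper bound of [b - a] and the modulus of [f] then yield
    an explicit Cauchy modulus. *)
Require Import Defs.
From mathcomp Require Import all_boot all_order all_algebra.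
From mathcomp Require Import ring lra.
Set Implicit Arguments. Unset Strict Implicit. Unset Printing Implicit Defensive.
Import Order.TTheory GRing.Theory Num.Theory.
Local Open Scope ring_scope.

Definition mkposrat (q : rat) (q0 : 0 < q) : posrat := exist _ q q0.

Definition posrat_half (e : posrat) : posrat :=
  mkposrat (divr_gt0 (svalP e) (ltr0Sn _ 1)).

Lemma ltr_pdivr_natS (R : archiRealFieldType) (c e : R) (n : nat) :
  0 < e -> (c / n.+1%:R < e) = (Num.truncn (c / e) <= n)%N.
Proof.
move=> e0; rewrite ltr_pdivrMr ?ltr0Sn // mulrC -ltr_pdivrMr //.
by rewrite truncn_le_nat.
Qed.

Lemma lower_add (x y : RD) (q r : rat) :
  lower x q -> lower y r -> lower (x + y)%RD (q + r).
Proof.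
move=> /lower_round[q' [qq' xq']] yr.
by exists q', r; split=> //; rewrite ltrD2r.
Qed.

Lemma upper_add (x y : RD) (q r : rat) :
  upper x q -> upper y r -> upper (x + y)%RD (q + r).
Proof.
move=> /upper_round[q' [q'q xq']] yr.
by exists q', r; split=> //; rewrite ltrD2r.
Qed.

Lemma upper_mul_rat (x : RD) (r c : rat) :
  0 < c -> upper x r -> upper (x * c%:RD)%RD (r * c).
Proof.
move=> c0 /upper_le[r' [r'r xr']]; apply/upper_le; exists (r' * c).
split; first by rewrite ltr_pM2r.
rewrite RDratM !(RDmulC _ c%:RD%RD).
by apply: RDmul_le xr'; apply: RDrat_le; apply: ltW.
Qed.

Lemma near_gt0 (x : RD) (p e : rat) : near x p e -> 0 < e.
Proof. by move=> [l u]; have := RD_transitive l u; lra. Qed.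

Lemma near_add (x y : RD) (p q d e : rat) :
  near x p d -> near y q e -> near (x + y)%RD (p + q) (d + e).
Proof.
move=> [lx ux] [ly uy]; split; last by rewrite addrACA; apply: upper_add.
by rewrite opprD addrACA; apply: lower_add.
Qed.

Lemma near_mul (x y : RD) (p q d e : rat) :
  near x p d -> near y q d -> d * (`|p| + `|q| + d) < e ->
  near (x * y)%RD (p * q) e.
Proof.
move=> nx ny de; have [lbox ubox] := box_near (near_gt0 nx) de.
by case: nx ny => [? ?] [? ?]; split;
   exists (p - d), (p + d), (q - d), (q + d).
Qed.

Definition ball (x : RD) (e : rat) (y : RD) : Prop := upper `|x - y|%RD e.

Lemma ball_sym (x y : RD) (e : rat) : ball x e y -> ball y e x.
Proof. by rewrite /ball RDabs_subC. Qed.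

Lemma ball_triangle (y x z : RD) (d e : rat) :
  ball x d y -> ball y e z -> ball x (d + e) z.
Proof.
rewrite /ball => -[uxy lxy] [uyz lyz].
have -> : (x - z = (x - y) + (y - z))%RD by RDeq x y z; ring.
split; first exact: upper_add.
by have := lower_add lxy lyz; rewrite -opprD.
Qed.

Lemma near_ball (x y : RD) (p d e : rat) :
  near x p d -> ball x e y -> near y p (d + e).
Proof.
move=> [l u] /ball_sym yx; split.
  by rewrite opprD addrA; apply: lower_dist l.
by rewrite addrA; apply: upper_dist u.
Qed.

Definition approximator (x : RD) : Type :=
  forall e : posrat, {p : rat | near x p (sval e)}.

Lemma approximator_locator (x : RD) : approximator x -> locator x.
Proof.
move=> ax q r qr; have e0 : 0 < (r - q) / 2 by lra.
have [p /= [l u]] := ax (mkposrat e0).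
have [qp|pq] := leP q (p - (r - q) / 2); first by left; apply: lowerW l.
by right; apply: upperW u; lra.
Qed.

(* An approximation to precision [e / 2] passes both tests of the search, and
   passing both certifies precision [e]. *)
Lemma locator_approximator (x : RD) : locator x -> approximator x.
Proof.
move=> lx [e /= e0].
have ltl p : p - e < p - e / 2 by lra.
have ltu p : p + e / 2 < p + e by lra.
pose accepted p := lx _ _ (ltl p) && ~~ lx _ _ (ltu p).
have accepted_near p : accepted p -> near x p e.
  by rewrite /accepted; case: (lx _ _ (ltl p)) => //; case: (lx _ _ (ltu p)).
have ex_accepted : exists p, accepted p.
  have [|p [l u]] := @near_ex x (e / 2); first lra.
  exists p; rewrite /accepted; case: (lx _ _ (ltl p)) => [_|u'] /=.
    case: (lx _ _ (ltu p)) => // l'.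
    by have := RD_transitive l' u; rewrite ltxx.
  by have := RD_transitive l u'; rewrite ltxx.
by have [p /accepted_near] := sigW ex_accepted; exists p.
Qed.

Lemma locator_upper_bound (x : RD) : locator x -> {r : rat | upper x r}.
Proof.
move=> /locator_approximator/(_ (mkposrat ltr01))[p [_ u]].
by exists (p + 1).
Qed.

Lemma locator_rat (p : rat) : locator p%:RD%RD.
Proof.
by move=> q r qr; have [qp|pq] := ltP q p; [left|right; apply: le_lt_trans qr].
Qed.

Lemma locator_opp (x : RD) : locator x -> locator (- x)%RD.
Proof. by move=> lx q r qr; have [||] := lx (- r) (- q); [lra|right|left]. Qed.

Lemma locator_add (x y : RD) : locator x -> locator y -> locator (x + y)%RD.
Proof.
move=> /locator_approximator ax /locator_approximator ay.
apply: approximator_locator => e.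
have [[p np] [q nq]] := (ax (posrat_half e), ay (posrat_half e)).
by exists (p + q); rewrite [sval e]splitr; apply: near_add.
Qed.

(* The radius granted by [mul_near_ex] is only known to exist, but a suitable
   one can be searched for once the approximations are chosen. *)
Lemma locator_mul (x y : RD) : locator x -> locator y -> locator (x * y)%RD.
Proof.
move=> /locator_approximator ax /locator_approximator ay.
apply: approximator_locator => e.
have ex_radius : exists d : posrat,
    sval d * (`|sval (ax d)| + `|sval (ay d)| + sval d) < sval e.
  have [d [d0 _ small]] := mul_near_ex x y (svalP e).
  exists (mkposrat d0).
  by apply: small; [exact: svalP (ax _)|exact: svalP (ay _)].
have [d small] := sigW ex_radius.
exists (sval (ax d) * sval (ay d)).
exact: near_mul (svalP (ax d)) (svalP (ay d)) small.
Qed.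

Lemma locator_sum (I : Type) (s : seq I) (P : pred I) (u : I -> RD) :
  (forall i, P i -> locator (u i)) ->
  locator (\big[RDadd/0%:RD%RD]_(i <- s | P i) u i).
Proof.
move=> lu; apply: (big_ind locator) => //; first exact: locator_rat.
exact: locator_add.
Qed.

Lemma locator_riemann_sum (f : RD -> RD) (a b : RD) (n : nat) :
  locator a -> locator b -> lifts_locators f -> locator (riemann_sum f a b n).
Proof.
move=> la lb lf.
have lh : locator ((b - a) * (n%:R^-1)%:RD)%RD.
  exact: locator_mul (locator_add lb (locator_opp la)) (locator_rat _).
apply: (locator_mul lh); apply: locator_sum => k _.
exact: lf (locator_add la (locator_mul (locator_rat _) lh)).
Qed.

Definition cauchy_modulus (u : nat -> RD) : Type :=
  forall e : posrat, {N : nat | forall m n : nat,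
    (N <= m)%N -> (N <= n)%N -> ball (u m) (sval e) (u n)}.

Definition cvg_modulus (u : nat -> RD) (l : RD) : Type :=
  forall e : posrat, {N : nat | forall n : nat,
    (N <= n)%N -> ball (u n) (sval e) l}.

Lemma cauchy_modulus_cvg (u : nat -> RD) (l : RD) :
  cauchy_modulus u -> cvg_to u l -> cvg_modulus u l.
Proof.
move=> cu ul e; have [N uN] := cu (posrat_half e); exists N => n Nn.
have [M ulM] := ul _ (svalP (posrat_half e)).
rewrite [sval e]splitr; apply: (@ball_triangle (u (maxn N M))).
  by apply: uN; rewrite ?leq_maxl.
exact/ulM/leq_maxr.
Qed.

Lemma locator_cvg (u : nat -> RD) (l : RD) :
  (forall n, locator (u n)) -> cvg_modulus u l -> locator l.
Proof.
move=> lu ul; apply: approximator_locator => e.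
have [N ulN] := ul (posrat_half e).
have [p np] := locator_approximator (lu N) (posrat_half e).
by exists p; rewrite [sval e]splitr; apply: near_ball np (ulN N _).
Qed.

Section RiemannSums.
Variables (f : RD -> RD) (a b : RD) (ab : (a <= b)%RD) (w : uc_modulus f a b).
Variables (D : rat) (bD : upper (b - a)%RD D).

Lemma riemann_sum_refine_ball (t : posrat) (n m : nat) :
  (0 < n)%N -> (0 < m)%N -> D / n%:R < sval (ucm_fun w t) ->
  ball (riemann_sum f a b n) (D * sval t) (riemann_sum f a b (n * m)).
Proof.
move=> n0 m0 mesh; apply: absle_upper (riemann_refine ab bD n0 m0 mesh) _.
exact: upper_mul_rat (svalP t) bD.
Qed.

Lemma riemann_sum_cauchy_modulus : cauchy_modulus (riemann_sum f a b).
Proof.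
move=> e; have D0 : 0 < D := RDle_upper (RDsubr_ge0 ab) bD.
pose t := mkposrat (divr_gt0 (svalP (posrat_half e)) D0).
have Dt : D * sval t = sval e / 2 by rewrite mulrC divfK ?gt_eqF.
pose N := (Num.truncn (D / sval (ucm_fun w t))).+1.
have ball_refinement m n : (N <= m)%N -> (N <= n)%N ->
    ball (riemann_sum f a b m) (sval e / 2) (riemann_sum f a b (m * n)).
  case: m n => [|m] [|n] // Nm _; rewrite -Dt.
  apply: riemann_sum_refine_ball => //.
  by rewrite ltr_pdivr_natS // (svalP (ucm_fun w t)).
exists N => m n Nm Nn; rewrite [sval e]splitr.
apply: ball_triangle (ball_refinement m n Nm Nn) _.
by rewrite mulnC; apply/ball_sym/ball_refinement.
Qed.

End RiemannSums.

Theorem theorem4p9 (a b : RD) (la : locator a) (lb : locator b)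
  (ab : (a <= b)%RD) (f : RD -> RD) (w : uc_modulus f a b)
  (lf : lifts_locators f) : locator (integral ab w).
Proof.
have [D bD] := locator_upper_bound (locator_add lb (locator_opp la)).
apply: locator_cvg (fun n => locator_riemann_sum n la lb lf) _.
have cR := riemann_sum_cauchy_modulus ab w bD.
exact: cauchy_modulus_cvg cR (integral_cvg ab w).
Qed.
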